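(* Let $\mathcal{M}$ and $\mathcal{H}$ be finite-dimensional real differentiable Riemannian manifolds, let $\mathcal{R}:\mathcal{H}\to\mathbb{R}$ and $F:\mathcal{M}\to\mathcal{H}$ be smooth, and let $\Theta\in\mathcal{M}$. Assume that the differential $DF(\Theta):T_\Theta\mathcal{M}\to T_{F(\Theta)}\mathcal{H}$ is surjective. Then a vector $\zeta^*\in T_\Theta\mathcal{M}$ satisfies $$DF(\Theta)[\zeta^*]=\operatorname{grad}\mathcal{R}(F(\Theta))$$ if and only if it satisfies $$DF(\Theta)^*DF(\Theta)[\zeta^*]=\operatorname{grad}(\mathcal{R}\circ F)(\Theta),$$ where $DF(\Theta)^*:T_{F(\Theta)}\mathcal{H}\to T_\Theta\mathcal{M}$ denotes the adjoint of $DF(\Theta)$ with respect to the corresponding Riemannian metrics. A particular solution is $$\zeta^*=\big(DF(\Theta)^*DF(\Theta)\big)^{+}[\operatorname{grad}(\mathcal{R}\circ F)(\Theta)],$$ where $(DF(\Theta)^*DF(\Theta))^{+}$ denotes the Moore--Penrose inverse.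
   Context: For a smooth real-valued function $g$ on a Riemannian manifold $\mathcal{N}$ with metric $\langle\cdot,\cdot\rangle_p$ on $T_p\mathcal{N}$, the Riemannian gradient $\operatorname{grad} g(p)\in T_p\mathcal{N}$ is defined by $Dg(p)[\zeta]=\langle\operatorname{grad} g(p),\zeta\rangle_p$ for all $\zeta\in T_p\mathcal{N}$. The Moore--Penrose inverse of a linear operator between finite-dimensional inner product spaces is taken with respect to the given inner products (here, the Riemannian metrics on the tangent spaces). *)

(* Defs.v *)
From HB Require Import structures.
From mathcomp Require Import all_boot all_order all_algebra.
From mathcomp Require Import sesquilinear.
From mathcomp Require Import all_classical all_reals all_analysis.

Set Implicit Arguments.
Unset Strict Implicit.
Unset Printing Implicit Defensive.

Import Order.TTheory GRing.Theory Num.Theory numFieldNormedType.Exports.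

Local Open Scope classical_set_scope.
Local Open Scope ring_scope.

Section Smooth.
Context {R : realType} {V W : normedModType R}.

(* For finite-dimensional V and an open set U, this is the usual C^k class. *)
Fixpoint Ck_on (k : nat) (U : set V) (f : V -> W) : Prop :=
  if k is k'.+1 then
    (forall x, U x -> differentiable f x) /\
    (forall v, Ck_on k' U (fun x => 'D_v f x))
  else forall x, U x -> {for x, continuous f}.

Definition smooth_on (U : set V) (f : V -> W) : Prop := forall k, Ck_on k U f.

Lemma smooth_on_differentiable (U : set V) (f : V -> W) (x : V) :
  smooth_on U f -> U x -> differentiable f x.
Proof. by move=> /(_ 1%N)[+ _]; apply. Qed.

Lemma near_is_diff (f g df : V -> W) (x : V) :
  (\forall y \near x, f y = g y) -> is_diff x f df -> is_diff x g df.
Proof.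
move=> fg [dfx <-].
have gx : g x = f x by rewrite (nbhs_singleton fg).
have gE : g \o shift x = cst (g x) + 'd f x +o_ 0 id.
  have /eqaddoP fE := diff_locally dfx.
  apply/eqaddoP => e e0; near=> h.
  have -> : (g \o shift x - (cst (g x) + 'd f x)) h =
            (f \o shift x - (cst (f x) + 'd f x)) h.
    rewrite !fctE/= gx; congr (_ - _).
    suff : f (h + x) = g (h + x) by [].
    near: h; move: fg; rewrite (near_shift 0 x); apply: filterS => h /=.
    by rewrite subr0.
  by near: h; exact: fE.
have dgf : 'd g x = 'd f x :> (V -> W).
  exact: diff_unique (diff_continuous dfx) gE.
by split=> //; apply/diff_locallyP; split; rewrite dgf//;
  exact: diff_continuous.
Unshelve. all: by end_near. Qed.

End Smooth.

(* A chart identifies the open set chart_dom of M with the open set chart_cod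
   of R^n; chart_map and chart_inv are irrelevant outside these two sets. *)
Record chart (R : realType) (n : nat) (M : topologicalType) := Chart {
  chart_dom : set M;
  chart_cod : set 'rV[R]_n;
  chart_map : M -> 'rV[R]_n;
  chart_inv : 'rV[R]_n -> M;
  chart_dom_open : open chart_dom;
  chart_cod_open : open chart_cod;
  chart_map_cod : forall p, chart_dom p -> chart_cod (chart_map p);
  chart_inv_dom : forall x, chart_cod x -> chart_dom (chart_inv x);
  chart_mapK : forall p, chart_dom p -> chart_inv (chart_map p) = p;
  chart_invK : forall x, chart_cod x -> chart_map (chart_inv x) = x;
  chart_map_continuous :
    forall p, chart_dom p -> {for p, continuous chart_map};
  chart_inv_continuous :
    forall x, chart_cod x -> {for x, continuous chart_inv}
}.

Definition transition (R : realType) (n : nat) (M : topologicalType)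
    (c d : chart R n M) : 'rV[R]_n -> 'rV[R]_n :=
  chart_map d \o chart_inv c.

HB.mixin Record isManifold (R : realType) (n : nat) M of Topological M := {
  manifold_hausdorff : hausdorff_space M;
  manifold_second_countable : @second_countable M;
  atlas : set (chart R n M);
  atlas_cover : forall p : M, exists c, atlas c /\ chart_dom c p;
  atlas_smooth : forall c d, atlas c -> atlas d ->
    smooth_on [set x | chart_cod c x /\ chart_dom d (chart_inv c x)]
              (transition c d)
}.

#[short(type="manifoldType")]
HB.structure Definition Manifold (R : realType) (n : nat) :=
  {M of Topological M & isManifold R n M}.

Section TangentSpace.
Context {R : realType} {n : nat} {M : manifoldType R n}.
Implicit Types p : M.

Definition chart_at p : Type :=
  {c : chart R n M | atlas c /\ chart_dom c p}.

Definition some_chart p : chart_at p := cid (atlas_cover p).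

Definition dtransition p (c d : chart_at p) : 'rV[R]_n -> 'rV[R]_n :=
  'd (transition (sval c) (sval d)) (chart_map (sval c) p).

Lemma transition_is_diff p (c d : chart_at p) :
  is_diff (chart_map (sval c) p) (transition (sval c) (sval d))
    (dtransition c d).
Proof.
apply/differentiableP; case: c d => [c [ac cp]] [d [ad dp]] /=.
apply: smooth_on_differentiable (atlas_smooth _ _ ac ad) _.
by split; [exact: chart_map_cod | rewrite chart_mapK].
Qed.

Lemma dtransition_comp p (c d e : chart_at p) (x : 'rV[R]_n) :
  dtransition d e (dtransition c d x) = dtransition c e x.
Proof.
have cd := transition_is_diff c d; have de := transition_is_diff d e.
have cp : chart_inv (sval c) (chart_map (sval c) p) = p.
  by apply: chart_mapK; case: (svalP c).
have xp : transition (sval c) (sval d) (chart_map (sval c) p) =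
          chart_map (sval d) p by rewrite /transition /= cp.
have dce : is_diff (chart_map (sval c) p)
    (transition (sval d) (sval e) \o transition (sval c) (sval d))
    (dtransition d e \o dtransition c d).
  have de' : is_diff (transition (sval c) (sval d) (chart_map (sval c) p))
      (transition (sval d) (sval e)) (dtransition d e) by rewrite xp.
  exact: (@is_diff_comp R _ _ _ _ _ _ _ _ cd de').
have near_e : \forall y \near chart_map (sval c) p,
    (transition (sval d) (sval e) \o transition (sval c) (sval d)) y =
    transition (sval c) (sval e) y.
  have [_ dp] := svalP d.
  have inv_cts : {for chart_map (sval c) p, continuous (chart_inv (sval c))}.
    by apply: chart_inv_continuous; apply: chart_map_cod; case: (svalP c).
  have dom_p : nbhs (chart_inv (sval c) (chart_map (sval c) p))
              (chart_dom (sval d)).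
    by rewrite cp; apply: open_nbhs_nbhs; split=> //; exact: chart_dom_open.
  near=> y; rewrite /transition /= chart_mapK//.
  by near: y; exact: inv_cts dom_p.
have [_ ce_eq] := near_is_diff near_e dce.
by rewrite [RHS]/dtransition ce_eq.
Unshelve. all: by end_near. Qed.

Lemma dtransition_id p (c : chart_at p) (x : 'rV[R]_n) :
  dtransition c c x = x.
Proof.
have near_id : \forall y \near chart_map (sval c) p,
    id y = transition (sval c) (sval c) y.
  have : nbhs (chart_map (sval c) p) (chart_cod (sval c)).
    apply: open_nbhs_nbhs; split; first exact: chart_cod_open.
    by apply: chart_map_cod; case: (svalP c).
  by apply: filterS => y cy; rewrite /transition /= chart_invK.
by have [_ idE] := near_is_diff near_id (is_diff_id _);
  rewrite /dtransition idE.
Qed.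

(* A tangent vector at p is given by its coordinates in every chart at p,
   subject to the usual transformation law under changes of charts. *)
Definition tangent_family p : {pred chart_at p -> 'rV[R]_n} :=
  fun v => `[< forall c d : chart_at p, v d = dtransition c d (v c) >].

Lemma tangent_family_submod p : submod_closed (@tangent_family p).
Proof.
split; first by apply/asboolP => c d; rewrite /dtransition linear0.
move=> a u v /asboolP hu /asboolP hv; apply/asboolP => c d.
by rewrite /dtransition linearP -!/(dtransition _ _ _) -hu -hv.
Qed.

HB.instance Definition _ p :=
  GRing.isSubmodClosed.Build R (chart_at p -> 'rV[R]_n) (@tangent_family p)
    (@tangent_family_submod p).

Record tangent p := Tangent {
  tangent_val : chart_at p -> 'rV[R]_n;
  tangent_valP : tangent_val \in @tangent_family p
}.

HB.instance Definition _ p := [isSub for @tangent_val p].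
HB.instance Definition _ p := [Choice of tangent p by <:].
HB.instance Definition _ p := [SubChoice_isSubLmodule of tangent p by <:].

Definition coord_in p (c : chart_at p) (v : tangent p) : 'rV[R]_n :=
  tangent_val v c.

Lemma coord_in_is_linear p (c : chart_at p) : linear (coord_in c).
Proof. by []. Qed.

HB.instance Definition _ p (c : chart_at p) :=
  GRing.isLinear.Build R (tangent p) 'rV[R]_n _ (coord_in c)
    (@coord_in_is_linear p c).

Lemma of_coord_subproof p (c : chart_at p) (x : 'rV[R]_n) :
  (dtransition c)^~ x \in @tangent_family p.
Proof. by apply/asboolP => d e; rewrite dtransition_comp. Qed.

Definition of_coord p (c : chart_at p) (x : 'rV[R]_n) : tangent p :=
  Tangent (of_coord_subproof c x).

Lemma of_coord_is_linear p (c : chart_at p) : linear (of_coord c).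
Proof.
move=> a x y; apply/val_inj/funext => d.
exact: (linearP ('d (transition (sval c) (sval d)) (chart_map (sval c) p))).
Qed.

HB.instance Definition _ p (c : chart_at p) :=
  GRing.isLinear.Build R 'rV[R]_n (tangent p) _ (of_coord c)
    (@of_coord_is_linear p c).

Lemma of_coordK p (c : chart_at p) : cancel (of_coord c) (coord_in c).
Proof. by move=> x; rewrite /coord_in /= dtransition_id. Qed.

Lemma coord_inK p (c : chart_at p) : cancel (coord_in c) (of_coord c).
Proof.
move=> v; apply/val_inj/funext => d /=.
by have /asboolP/(_ c d) := tangent_valP v.
Qed.

Lemma tangent_vect_iso p : Vector.axiom n (tangent p).
Proof.
exists (coord_in (some_chart p)); first exact: coord_in_is_linear.
by exists (of_coord (some_chart p)); [exact: coord_inK | exact: of_coordK].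
Qed.

HB.instance Definition _ p :=
  Lmodule_hasFinDim.Build R (tangent p) (tangent_vect_iso p).

(* On chart_dom c, this is the vector field with constant coordinates x in c. *)
Definition coord_field (c : chart R n M) (x : 'rV[R]_n) (p : M) : tangent p :=
  if pselect (atlas c /\ chart_dom c p) is left h then
    of_coord (exist _ c h : chart_at p) x
  else 0.

End TangentSpace.

HB.mixin Record isRiemannian (R : realType) (n : nat) M of Manifold R n M := {
  metric : forall p : M, {dot tangent p for idfun};
  metric_smooth : forall (c : chart R n M) (x y : 'rV[R]_n), atlas c ->
    smooth_on (chart_cod c)
      (fun z => metric (chart_inv c z) (coord_field c x (chart_inv c z))
                                       (coord_field c y (chart_inv c z)) : R)
}.

#[short(type="riemannianType")]
HB.structure Definition Riemannian (R : realType) (n : nat) :=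
  {M of Manifold R n M & isRiemannian R n M}.

Section SmoothMaps.
Context {R : realType} {m n : nat} {M : manifoldType R m}
  {N : manifoldType R n}.

Definition smooth_fun (g : M -> R) : Prop :=
  forall c : chart R m M, atlas c -> smooth_on (chart_cod c) (g \o chart_inv c).

Definition smooth_map (F : M -> N) : Prop :=
  continuous F /\
  forall (c : chart R m M) (d : chart R n N), atlas c -> atlas d ->
    smooth_on [set x | chart_cod c x /\ chart_dom d (F (chart_inv c x))]
              (chart_map d \o F \o chart_inv c).

(* The two differentials below are computed in arbitrary charts; by the chain
   rule they do not depend on this choice when the functions are smooth. *)
Definition differential_fun (g : M -> R) (p : M) (v : tangent p) : R :=
  let c := some_chart p in
  'd (g \o chart_inv (sval c)) (chart_map (sval c) p) (coord_in c v).

Definition differential (F : M -> N) (p : M) :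
    'Hom(tangent p, tangent (F p)) :=
  let c := some_chart p in
  let d := some_chart (F p) in
  linfun (of_coord d
    \o 'd (chart_map (sval d) \o F \o chart_inv (sval c)) (chart_map (sval c) p)
    \o coord_in c).

End SmoothMaps.

Arguments differential_fun {R m M} g p v.

Section Forms.
Context {R : realType}.

Section Dot.
Context {V : vectType R} (g : {dot V for idfun}).

Lemma dotC u v : g u v = g v u.
Proof. by rewrite hermC expr0 mul1r. Qed.

Lemma dot_eq0 u : g u u = 0 -> u = 0.
Proof.
move=> uu; apply/eqP; apply: contra_eqT uu => u0.
by rewrite gt_eqF// neq0_dnorm_gt0.
Qed.

Lemma dot_linr v : linear_for *%R (g v).
Proof. by move=> a x y; rewrite linearPr. Qed.

Lemma dot_linl v : linear_for *%R (g^~ v).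
Proof. by move=> a x y; rewrite linearPl. Qed.

Lemma dotBr u v w : g u (v - w) = g u v - g u w.
Proof. by rewrite linearBr. Qed.

Lemma dotBl u v w : g (v - w) u = g v u - g w u.
Proof. by rewrite linearBl. Qed.

End Dot.

Section Riesz.
Context {V : vectType R} (f : V -> V -> R).
Context (f_linr : forall v, linear_for *%R (f v))
  (f_linl : forall v, linear_for *%R (f^~ v))
  (f0 : forall u, f u u = 0 -> u = 0).

Lemma riesz (phi : V -> R) :
  linear_for *%R phi -> exists u, forall v, phi v = f u v.
Proof.
move=> phil.
pose mk (p : V -> R) (pl : linear_for *%R p) : {linear V -> R^o} :=
  HB.pack (p : V -> R^o) (GRing.isLinear.Build R V R^o _ p pl).
have mkE p pl v : linfun (mk p pl) v = p v by rewrite lfunE.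
pose T u : 'Hom(V, R^o) := linfun (mk (f u) (f_linr u)).
have Tl : linear T.
  by move=> a x y; apply/lfunP => z; rewrite add_lfunE scale_lfunE !mkE f_linl.
pose T' : {linear V -> 'Hom(V, R^o)} :=
  HB.pack T (GRing.isLinear.Build R V 'Hom(V, R^o) _ T Tl).
have T'E u : linfun T' u = T u by rewrite lfunE.
have ker0 : lker (linfun T') == 0%VS.
  rewrite -subv0; apply/subvP => u; rewrite memv_ker T'E => /eqP/lfunP/(_ u).
  by rewrite mkE zero_lfunE memv0 => /f0 ->.
have : limg (linfun T') = fullv.
  apply/eqP; rewrite eqEdim subvf/= limg_dim_eq ?(eqP ker0) ?capv0//.
  by rewrite !dimvf /dim/= muln1.
move/vspaceP/(_ (linfun (mk phi phil))); rewrite memvf => /memv_imgP[u _ uE].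
by exists u => v; rewrite -(mkE phi phil) uE T'E mkE.
Qed.

Lemma adjoint_exists (W : vectType R) (h : W -> W -> R) (A : 'Hom(V, W)) :
  (forall u v, f u v = f v u) ->
  (forall v, linear_for *%R (h v)) -> (forall v, linear_for *%R (h^~ v)) ->
  exists B : 'Hom(W, V), forall v w, h (A v) w = f v (B w).
Proof.
move=> fC hr hl.
have ex w : exists u, forall v, h (A v) w = f u v.
  apply: riesz => //.
  by move=> a x y; rewrite linearP /= hl.
pose b w := sval (cid (ex w)).
have bE w v : h (A v) w = f (b w) v by rewrite /b; case: cid.
have bl : linear b.
  move=> a x y; set u := b _; apply/eqP; rewrite -subr_eq0; apply/eqP/f0.
  have fB u1 u2 v : f (u1 - u2) v = f u1 v - f u2 v.
    by rewrite addrC -scaleN1r f_linl mulN1r addrC.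
  by rewrite {1}fB f_linl -!bE hr subrr.
exists (linfun
  (HB.pack_for {linear W -> V} b (GRing.isLinear.Build R W V _ b bl))).
by move=> v w; rewrite lfunE/= fC bE.
Qed.

End Riesz.

Section Adjoint.
Context {V W : vectType R}.
Context (g : {dot V for idfun}) (h : {dot W for idfun}).

Definition is_adjoint (A : 'Hom(V, W)) (B : 'Hom(W, V)) : Prop :=
  forall v w, h (A v) w = g v (B w).

Definition adjoint (A : 'Hom(V, W)) : 'Hom(W, V) := xget 0 (is_adjoint A).

Lemma adjointP (A : 'Hom(V, W)) : is_adjoint A (adjoint A).
Proof.
have adj_ex : exists B : 'Hom(W, V), is_adjoint A B.
  apply: adjoint_exists.
  - exact: dot_linr.
  - exact: dot_linl.
  - exact: dot_eq0.
  - exact: dotC.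
  - exact: dot_linr.
  - exact: dot_linl.
exact: xgetPex adj_ex.
Qed.

End Adjoint.

Lemma ortho_proj (V : vectType R) (g : {dot V for idfun}) (U : {vspace V}) :
  exists P : 'Hom(V, V), [/\ forall v, P v \in U,
    forall v, v \in U -> P v = v & forall v w, g (P v) w = g v (P w)].
Proof.
pose iota : 'Hom(subvs_of U, V) := linfun vsval.
pose f (x y : subvs_of U) := g (vsval x) (vsval y).
have [B BP] : exists B : 'Hom(V, subvs_of U),
    forall v w, g (iota v) w = f v (B w).
  apply: adjoint_exists => //; rewrite /f.
  - by move=> v a x y; exact: dot_linr.
  - by move=> v a x y; exact: dot_linl.
  - by move=> u /dot_eq0 u0; apply/val_inj; rewrite /= u0.
  - by move=> u v; rewrite dotC.
  - exact: dot_linr.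
  - exact: dot_linl.
have BP' (v : subvs_of U) (w : V) :
    g (vsval v) w = g (vsval v) (vsval (B w)) by have := BP v w; rewrite lfunE.
exists (iota \o B)%VF; split.
- by move=> v; rewrite comp_lfunE lfunE subvsP.
- move=> v vU; rewrite comp_lfunE lfunE/=.
  have BK (s : subvs_of U) : B (vsval s) = s.
    apply/eqP; rewrite -subr_eq0; set d := _ - _.
    suff d0 : g (vsval d) (vsval d) = 0 by apply/eqP/val_inj; exact: dot_eq0 d0.
    have vd : vsval d = vsval (B (vsval s)) - vsval s by [].
    by rewrite {2}vd dotBr -BP' subrr.
  by rewrite -[in LHS](vsprojK vU) BK vsprojK.
- move=> v w; rewrite !comp_lfunE !lfunE/= BP' dotC [RHS]dotC.
  by rewrite [RHS]BP'.
Qed.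

Section MoorePenrose.
Context {V W : vectType R}.
Context (g : {dot V for idfun}) (h : {dot W for idfun}).

(* The four Penrose equations, with respect to the inner products g and h. *)
Definition is_moore_penrose (A : 'Hom(V, W)) (B : 'Hom(W, V)) : Prop :=
  [/\ (A \o B \o A = A)%VF, (B \o A \o B = B)%VF,
      forall w w', h ((A \o B)%VF w) w' = h w ((A \o B)%VF w') &
      forall v v', g ((B \o A)%VF v) v' = g v ((B \o A)%VF v')].

Definition moore_penrose (A : 'Hom(V, W)) : 'Hom(W, V) :=
  xget 0 (is_moore_penrose A).

Lemma moore_penroseP (A : 'Hom(V, W)) : is_moore_penrose A (moore_penrose A).
Proof.
have [P [PU Pid Psym]] := ortho_proj h (limg A).
have [Q [QU Qid Qsym]] := ortho_proj g (lker A).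
pose B := ((\1 - Q) \o A^-1 \o P)%VF.
have AQ v : A (Q v) = 0 by apply/eqP; rewrite -memv_ker.
have AB : (A \o B = P)%VF.
  apply/lfunP => w; rewrite !comp_lfunE add_lfunE opp_lfunE id_lfunE linearB /=.
  by rewrite AQ subr0 limg_lfunVK.
have BA : (B \o A = \1 - Q)%VF.
  apply/lfunP => v; rewrite !comp_lfunE (Pid (A v)) ?memv_img ?memvf//.
  have kv : A^-1%VF (A v) - v \in lker A.
    by rewrite memv_ker linearB/= limg_lfunVK ?subrr// memv_img ?memvf.
  rewrite !add_lfunE !opp_lfunE !id_lfunE.
  have := Qid _ kv; rewrite linearB /= => /(canRL (subrK _)) ->.
  by rewrite opprD opprB addrA addrCA subrr addr0.
apply: (xgetPex 0 (ex_intro (is_moore_penrose A) B _)); split.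
- apply/lfunP => v; rewrite AB comp_lfunE Pid// memv_img ?memvf//.
- apply/lfunP => w; rewrite BA !comp_lfunE !add_lfunE !opp_lfunE !id_lfunE.
  by rewrite [Q (_ - _)]linearB /= [Q (Q _)]Qid// subrr subr0.
- by rewrite AB.
- move=> v v'; rewrite BA !add_lfunE !opp_lfunE !id_lfunE.
  by rewrite dotBr dotBl Qsym.
Qed.

End MoorePenrose.

End Forms.

Section Gradient.
Context {R : realType} {n : nat} {M : riemannianType R n}.

Definition is_grad (g : M -> R) (p : M) (v : tangent p) : Prop :=
  forall z : tangent p, differential_fun g p z = metric p v z.

Definition grad (g : M -> R) (p : M) : tangent p := xget 0 (@is_grad g p).

Lemma gradP (g : M -> R) (p : M) : is_grad g (grad g p).
Proof.
have grad_ex : exists u : tangent p, is_grad g u.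
  apply: riesz; [exact: dot_linr | exact: dot_linl | exact: dot_eq0 |].
  by move=> a x y; rewrite /differential_fun !linearP.
exact: xgetPex grad_ex.
Qed.

End Gradient.

(* Main.v *)
Require Import Defs.
From mathcomp Require Import all_boot all_order all_algebra.
From mathcomp Require Import sesquilinear.
From mathcomp Require Import all_classical all_reals all_analysis.

Import GRing.Theory numFieldNormedType.Exports.

(** Write [A] for the differential of [F] at [Theta] and [b] for the gradient of
    [calR] at [F Theta].  By the chain rule,
    [D(calR \o F)[z] = D calR [A z] = <b, A z> = <A^* b, z>], so the gradient of
    [calR \o F] at [Theta] is [A^* b] ([grad_comp]).  The second equation of the
    theorem is therefore the normal equation [A^* A zeta = A^* b] of the first
    one, [A zeta = b].  Since [A] is surjective, [A^*] is injective
    ([adjoint_inj]) and may be cancelled from the normal equation.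

    Surjectivity of [A] moreover provides some solution of [A zeta = b], so
    [A^* b] lies in the range of [A^* A]; a Moore-Penrose inverse of an operator
    sends each vector of its range to a preimage of that vector
    ([moore_penroseK]). *)

Local Open Scope ring_scope.

Section LinearAlgebra.
Context {R : realType} {V W : vectType R}.
Context (g : {dot V for idfun}) (h : {dot W for idfun}).

(** A vector [w] with [A^* w = 0] is orthogonal to the range of [A], that is, to
    the whole space and in particular to itself. *)
Lemma adjoint_inj (A : 'Hom(V, W)) :
  (forall w, exists v, A v = w) -> injective (adjoint g h A).
Proof.
move=> A_surj w w' eq_ww'; apply/eqP; rewrite -subr_eq0; apply/eqP.
have [v Av] := A_surj (w - w').
apply: (@dot_eq0 _ _ h).
by rewrite -{1}Av (adjointP g h) linearB /= eq_ww' subrr linear0r.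
Qed.

(** The Penrose equation [A A^+ A = A], read on the range of [A]. *)
Lemma moore_penroseK (A : 'Hom(V, W)) (w : W) :
  (exists v, A v = w) -> A (moore_penrose g h A w) = w.
Proof.
case=> v <-; have [AXA _ _ _] := moore_penroseP g h A.
by rewrite -[RHS](congr1 (fun f : 'Hom(V, W) => f v) AXA) !comp_lfunE.
Qed.

End LinearAlgebra.

Section ChainRule.
Context {R : realType} {m n : nat} {M : manifoldType R m}
  {N : manifoldType R n}.
Implicit Types (F : M -> N) (g : N -> R) (p : M).

(** In coordinates, [g \o F] is the composite of the representatives of [g] and
    [F] only where [F] takes its values in the chart around [F p]; by continuity
    of [F] this holds near [p], which suffices for the differentials. *)
Lemma differential_fun_comp g F p (v : tangent p) :
  smooth_fun g -> smooth_map F ->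
  differential_fun (g \o F) p v =
  differential_fun g (F p) (differential F p v).
Proof.
move=> g_smooth [F_cont F_smooth].
rewrite /differential_fun /differential lfunE /= dtransition_id.
set c := some_chart p; set d := some_chart (F p).
have [c_atlas cp] := svalP c; have [d_atlas dFp] := svalP d.
set x := chart_map (sval c) p.
have cx : chart_cod (sval c) x by exact: chart_map_cod.
have cxp : chart_inv (sval c) x = p by exact: chart_mapK.
pose Fcd := chart_map (sval d) \o F \o chart_inv (sval c).
pose gd := g \o chart_inv (sval d).
have Fx : Fcd x = chart_map (sval d) (F p) by rewrite /Fcd /= cxp.
have dF : differentiable Fcd x.
  apply: smooth_on_differentiable (F_smooth _ _ c_atlas d_atlas) _.
  by split=> //; rewrite cxp.
have dg : differentiable gd (Fcd x).
  apply: smooth_on_differentiable (g_smooth _ d_atlas) _.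
  by rewrite Fx; exact: chart_map_cod.
have near_eq : \forall y \near x,
    (gd \o Fcd) y = ((g \o F) \o chart_inv (sval c)) y.
  have dom_Fx : nbhs (F (chart_inv (sval c) x)) (chart_dom (sval d)).
    rewrite cxp; apply: open_nbhs_nbhs.
    by split=> //; exact: chart_dom_open.
  have near_dom : \forall y \near x,
      chart_dom (sval d) (F (chart_inv (sval c) y)).
    exact: continuous_comp (chart_inv_continuous cx) (F_cont _) _ dom_Fx.
  by apply: filterS near_dom => y dFy; rewrite /gd /Fcd /= chart_mapK.
have [_ ->] := near_is_diff near_eq
  (is_diff_comp (differentiableP dF) (differentiableP dg)).
by rewrite /= Fx.
Qed.

End ChainRule.

Section Gradients.
Context {R : realType} {m n : nat} {M : riemannianType R m}
  {N : riemannianType R n}.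

Lemma grad_unique (g : M -> R) (p : M) (u : tangent p) :
  is_grad g u -> grad g p = u.
Proof.
move=> gu; apply/eqP; rewrite -subr_eq0; apply/eqP.
by apply: (@dot_eq0 _ _ (metric p)); rewrite dotBl -gu -gradP subrr.
Qed.

Lemma grad_comp (g : N -> R) (F : M -> N) (p : M) :
  smooth_fun g -> smooth_map F ->
  grad (g \o F) p =
  adjoint (metric p) (metric (F p)) (differential F p) (grad g (F p)).
Proof.
move=> g_smooth F_smooth; apply: grad_unique => z.
by rewrite differential_fun_comp// gradP dotC (adjointP (metric p)) dotC.
Qed.

End Gradients.

Theorem lemma2p1 (R : realType) (m n : nat) (M : riemannianType R m)
    (H : riemannianType R n) (calR : H -> R) (F : M -> H) (Theta : M)
    (calR_smooth : smooth_fun calR) (F_smooth : smooth_map F)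
    (dF_surj : forall w : tangent (F Theta),
       exists v : tangent Theta, differential F Theta v = w) :
  let dF := differential F Theta in
  let dFadj := adjoint (metric Theta) (metric (F Theta)) dF in
  (forall zeta : tangent Theta,
     dF zeta = grad calR (F Theta) <->
     (dFadj \o dF)%VF zeta = grad (calR \o F) Theta) /\
  (let zeta := moore_penrose (metric Theta) (metric Theta) (dFadj \o dF)%VF
                 (grad (calR \o F) Theta) in
   dF zeta = grad calR (F Theta) /\
   (dFadj \o dF)%VF zeta = grad (calR \o F) Theta).
Proof.
move=> dF dFadj.
have normal_eq zeta : dF zeta = grad calR (F Theta) <->
    (dFadj \o dF)%VF zeta = grad (calR \o F) Theta.
  rewrite grad_comp// comp_lfunE; split=> [->//|].
  exact: adjoint_inj.
split=> // zeta.
have zetaP : (dFadj \o dF)%VF zeta = grad (calR \o F) Theta.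
  apply: moore_penroseK.
  have [v dFv] := dF_surj (grad calR (F Theta)).
  by exists v; apply/normal_eq.
by split=> //; apply/normal_eq.
Qed.
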